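(* There exists a positive numerical constant $c$ such that, for any $n\ge 2$, $m\ge 1$, any integer length $1\le r\le n/4$ and any $\zeta\in(0,1/4)$, the following holds. Provided that $$r\zeta^2\le c\,\frac{\log(n/r)}m,$$ we have $$\inf_{\hat\tau}\ \sup_{\eta\in\bar{\mathcal P}(r,\zeta)}\mathbb P_\eta(\hat K\ne K)\ge\frac14,$$ where the infimum is over all estimators $\hat\tau$ of the change-point vector and $\hat K=|\hat\tau|$.
   Context: Let $m\ge1$. For a sequence $\eta=(F_1,\dots,F_n)$ of cumulative distribution functions on $\mathbb R$, $\mathbb P_\eta$ is the distribution of $(y_1,\dots,y_n)$ where the $y_t$ are independent and $y_t$ is an i.i.d. sample of size $m$ from $F_t$. The change-points of $\eta$ are the integers $1=\tau_0<\tau_1<\dots<\tau_K<\tau_{K+1}=n+1$ such that $F_t$ is constant in $t$ on each $[\tau_k,\tau_{k+1}-1]$ and $F_{\tau_k}\ne F_{\tau_k-1}$; $K=K(\eta)\ge0$; $r_k=\min(\tau_{k+1}-\tau_k,\tau_k-\tau_{k-1})$. $\|F-G\|_\infty=\sup_z|F(z)-G(z)|$. $\bar{\mathcal P}(r,\zeta)$ is the collection of sequences $\eta=(F_1,\dots,F_n)$ whose change-points satisfy $\min_kr_k\ge r$ and $\min_k\|F_{\tau_k}-F_{\tau_{k-1}}\|_\infty\ge\zeta$ (constant sequences, $K=0$, are included). An estimator $\hat\tau=(\hat\tau_1,\dots,\hat\tau_{\hat K})$ is any measurable function of $(y_1,\dots,y_n)$ with values in finite increasing vectors. *)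

(* Defs.v *)
From HB Require Import structures.
From mathcomp Require Import all_boot all_order all_algebra.
From mathcomp Require Import all_classical all_reals all_analysis.

Set Implicit Arguments.
Unset Strict Implicit.
Unset Printing Implicit Defensive.
Import Order.TTheory GRing.Theory Num.Theory.
Import numFieldNormedType.Exports.

Local Open Scope classical_set_scope.
Local Open Scope ring_scope.

(* The law of a tuple with independent entries, entry i having law P i; it is *)
(* built by iterating the binary product measure, see [product_law_box].      *)
Section product_law.
Context d (T : measurableType d) (R : realType).

Definition tuple_cons n (x : T * n.-tuple T) : n.+1.-tuple T :=
  [the n.+1.-tuple T of x.1 :: x.2].

Lemma measurable_tuple_cons n : measurable_fun [set: T * n.-tuple T] (@tuple_cons n).
Proof. exact: (measurable_cons measurable_fst measurable_snd). Qed.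

HB.instance Definition _ n :=
  @isMeasurableFun.Build _ _ _ _ (@tuple_cons n) (@measurable_tuple_cons n).

Fixpoint product_law n : ('I_n -> probability T R) -> probability (n.-tuple T) R :=
  match n with
  | 0 => fun _ => \d_ ([tuple] : 0.-tuple T)
  | n'.+1 => fun P => distribution
      ((P ord0 \x product_law (fun i => P (lift ord0 i)))%E
         : probability (T * n'.-tuple T)%type R)
      (@tuple_cons n')
  end.

Lemma measurable_box n (A : 'I_n -> set T) : (forall i, measurable (A i)) ->
  measurable [set x : n.-tuple T | forall i, A i (tnth x i)].
Proof.
move=> mA; rewrite (_ : [set _ | _] =
    \bigcap_(i in [set: 'I_n]) ((@tnth n T)^~ i @^-1` A i)).
  apply: fin_bigcap_measurable => // i _.
  by rewrite -[X in measurable X]setTI; exact: measurable_tnth.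
by apply/seteqP; split=> x /= h; [move=> i _|move=> i]; exact: h.
Qed.

Lemma product_law_box n (P : 'I_n -> probability T R) (A : 'I_n -> set T) :
  (forall i, measurable (A i)) ->
  product_law P [set x | forall i, A i (tnth x i)] = (\prod_i P i (A i))%E.
Proof.
elim: n P A => [|n IHn] P A mA.
  rewrite big_ord0 /= diracE mem_set//.
  by move=> -[].
rewrite big_ord_recl -IHn//.
rewrite -product_measure1E//; last first.
  by apply: (@measurable_box n (fun i => A (lift ord0 i))).
rewrite /= /distribution /pushforward; congr (_ _).
apply/seteqP; split=> -[x y] /=.
  move=> h; split; first exact: (h ord0).
  by move=> i; have := h (lift ord0 i); rewrite tnthS.
move=> [h0 h] i; case: (unliftP ord0 i) => [j ->|->] //.
by rewrite tnthS.
Qed.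
End product_law.

Section model.
Context (R : realType).

Definition sample_law n m (eta : 'I_n -> cumulativeBounded (0 : R) (1 : R)) :
    probability (n.-tuple (m.-tuple (measurableTypeR R))) R :=
  product_law (fun t => product_law (fun _ : 'I_m =>
    (lebesgue_stieltjes_measure (eta t) : probability (measurableTypeR R) R))).

(* Times run over 1, ..., n, so F_t is [eta] at the ordinal of value t - 1; *)
(* the value outside 1, ..., n is never used.                               *)
Definition cdf_at n (eta : 'I_n -> cumulativeBounded (0 : R) (1 : R)) (t : nat) :
    R -> R :=
  oapp (fun i : 'I_n => eta i : R -> R) (fun=> 0) (insub t.-1).

(* tau_0 = 1, tau_1, ..., tau_K, tau_(K+1) = n + 1, where tau lists tau_1, ..., tau_K *)
Definition extended n (tau : seq nat) : seq nat := 1%N :: rcons tau n.+1.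

Definition is_change_points n (eta : 'I_n -> cumulativeBounded (0 : R) (1 : R))
    (tau : seq nat) : Prop :=
  let tau_ := nth 0%N (extended n tau) in
  [/\ sorted ltn (extended n tau),
      forall k s t, (k <= size tau)%N ->
        (tau_ k <= s < tau_ k.+1)%N -> (tau_ k <= t < tau_ k.+1)%N ->
        cdf_at eta s = cdf_at eta t
    & forall k, (1 <= k <= size tau)%N ->
        cdf_at eta (tau_ k) <> cdf_at eta (tau_ k).-1].

(* For n > 0 exactly one list qualifies, see [is_change_pointsE]. *)
Definition change_points n (eta : 'I_n -> cumulativeBounded (0 : R) (1 : R)) :
    seq nat :=
  xget [::] [set tau | is_change_points eta tau].

Lemma nth_extended_lt n tau i j : sorted ltn (extended n tau) ->
  (j <= (size tau).+1)%N -> (i < j)%N ->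
  (nth 0 (extended n tau) i < nth 0 (extended n tau) j)%N.
Proof.
move=> s_tau lej ltij.
by apply: (sorted_ltn_nth ltn_trans _ s_tau);
  rewrite ?inE ?[size _]/= ?size_rcons ?ltnS // ltnW ?(leq_trans ltij).
Qed.

Lemma nth_extended_last n tau : nth 0%N (extended n tau) (size tau).+1 = n.+1.
Proof. by rewrite /= nth_rcons ltnn eqxx. Qed.

Lemma mem_extended n tau t : reflect
  (exists2 k, (1 <= k <= size tau)%N & t = nth 0%N (extended n tau) k) (t \in tau).
Proof.
have nthE k : (k < size tau)%N -> nth 0%N (extended n tau) k.+1 = nth 0%N tau k.
  by move=> lek; rewrite /= nth_rcons lek.
apply: (iffP (nthP 0%N)) => [[k lek <-]|[[//|k] /= lek ->]].
  by exists k.+1; rewrite ?nthE.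
by exists k; rewrite // -nthE.
Qed.

Lemma extended_segment n tau t : (1 <= t <= n)%N ->
  exists2 k, (k <= size tau)%N &
    (nth 0 (extended n tau) k <= t < nth 0 (extended n tau) k.+1)%N.
Proof.
move=> /andP[t1 tn]; pose P k := (t < nth 0 (extended n tau) k)%N.
have Pmax : P (size tau).+1 by rewrite /P nth_extended_last ltnS.
have exP : exists k, P k by exists (size tau).+1.
case: (ex_minnP exP) => -[|k] Pk kmin; first by move: Pk; rewrite /P /= ltnNge t1.
exists k; first by have := kmin _ Pmax.
apply/andP; split=> //; rewrite leqNgt; apply/negP => /kmin.
by rewrite ltnn.
Qed.

(* The change-points are the times t in 2, ..., n with F_t <> F_(t-1). *)
Lemma is_change_pointsE n (eta : 'I_n -> cumulativeBounded (0 : R) (1 : R)) tau :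
  (0 < n)%N -> is_change_points eta tau <->
  tau = [seq t <- iota 2 n.-1 | `[< cdf_at eta t <> cdf_at eta t.-1 >]].
Proof.
move=> n0.
have mem_iotan t : (t \in iota 2 n.-1) = (2 <= t <= n)%N.
  by rewrite mem_iota add2n prednK// ltnS.
split=> [[s_ext cst jump]|->].
  apply: (irr_sorted_eq ltn_trans ltnn).
  - by move: s_ext => /= /path_sorted; rewrite -cats1 => /cat_sorted2[].
  - by apply: sorted_filter; [exact: ltn_trans|exact: iota_ltn_sorted].
  move=> t; rewrite mem_filter mem_iotan; apply/idP/idP.
    case/(mem_extended n) => k /andP[k1 lek] ->; apply/andP; split.
      by apply/asboolP; apply: jump; rewrite k1.
    apply/andP; split; first exact: (@nth_extended_lt n tau 0 k s_ext (leqW lek)).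
    by rewrite -ltnS -(nth_extended_last n tau) nth_extended_lt.
  case/andP=> /asboolP Pt /andP[t2 tn].
  have [k lek /andP[kt tk]] : exists2 k, (k <= size tau)%N &
      (nth 0 (extended n tau) k <= t < nth 0 (extended n tau) k.+1)%N.
    by apply: extended_segment; rewrite (ltnW t2).
  move: kt; rewrite leq_eqVlt => /orP[/eqP tE|kt].
    apply/(mem_extended n); exists k => //; rewrite lek andbT.
    by case: k tE {lek tk} => // tE; move: t2; rewrite -tE.
  case: Pt; apply: (cst k) => //; first by rewrite (ltnW kt).
  by case: t t2 tn kt tk => // t _ _; rewrite ltnS => -> /= /ltnW.
set tau' := [seq t <- _ | _].
have mem_tau' t : (t \in tau') = `[< cdf_at eta t <> cdf_at eta t.-1 >] && (2 <= t <= n)%N.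
  by rewrite mem_filter mem_iotan.
have s_tau' : sorted ltn tau'.
  by apply: sorted_filter; [exact: ltn_trans|exact: iota_ltn_sorted].
have s_ext : sorted ltn (extended n tau').
  rewrite /= rcons_path; apply/andP; split.
    rewrite path_min_sorted//; apply/allP => t; rewrite mem_tau'.
    by case/and3P.
  change (last 1%N tau' < n.+1)%N.
  have := mem_last 1%N tau'; rewrite inE => /predU1P[->|]; first by rewrite ltnS.
  by rewrite mem_tau' ltnS => /and3P[].
split=> //; last first.
  move=> k kP; suff : nth 0%N (extended n tau') k \in tau'.
    by rewrite mem_tau' => /andP[/asboolP].
  by apply/(mem_extended n); exists k.
move=> k s t lek.
suff cst u : (nth 0 (extended n tau') k <= u < nth 0 (extended n tau') k.+1)%N ->
    cdf_at eta u = cdf_at eta (nth 0%N (extended n tau') k).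
  by move=> /cst -> /cst ->.
set a := nth _ _ k; set b := nth _ _ k.+1.
have a1 : (1 <= a)%N.
  by rewrite /a; case: (k) lek => // k' lek'; apply: ltnW;
    apply: (@nth_extended_lt n tau' 0 k'.+1 s_ext (leqW lek')).
have bn : (b <= n.+1)%N.
  rewrite /b; move: lek; rewrite leq_eqVlt => /orP[/eqP->|ltk].
    by rewrite nth_extended_last.
  by apply: ltnW; rewrite -(nth_extended_last n tau') nth_extended_lt.
elim: u => [|u IHu]; first by rewrite leqNgt a1.
case/andP; rewrite leq_eqVlt => /orP[/eqP -> //|au] ub.
rewrite -IHu; last by rewrite -ltnS au (ltnW ub).
apply: contrapT => Pu.
have : u.+1 \in tau'.
  rewrite mem_tau'; apply/and3P; split; [exact/asboolP| |].
    exact: leq_ltn_trans a1 au.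
  by rewrite -ltnS (leq_trans ub).
case/(mem_extended n) => j /andP[_ lej] uE.
move: au ub; rewrite uE /a /b => au ub.
have [jk|kj] := leqP j k.
  move: au; rewrite ltnNge; move: jk; rewrite leq_eqVlt => /orP[/eqP->|jk].
    by rewrite leqnn.
  by rewrite ltnW// nth_extended_lt// leqW.
move: ub; rewrite ltnNge; move: kj; rewrite leq_eqVlt => /orP[/eqP->|kj].
  by rewrite leqnn.
by rewrite ltnW// nth_extended_lt// leqW.
Qed.

Lemma change_pointsE n (eta : 'I_n -> cumulativeBounded (0 : R) (1 : R)) :
  (0 < n)%N -> change_points eta =
  [seq t <- iota 2 n.-1 | `[< cdf_at eta t <> cdf_at eta t.-1 >]].
Proof.
move=> n0; apply/is_change_pointsE => //; rewrite /change_points.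
by case: xgetP => // /(_ _ ((is_change_pointsE eta _ n0).2 erefl)).
Qed.

Definition spacing n (tau : seq nat) (k : nat) : nat :=
  let tau_ := nth 0%N (extended n tau) in
  minn (tau_ k.+1 - tau_ k) (tau_ k - tau_ k.-1).

Definition supnorm (f : R -> R) : R := sup (range (fun z => `|f z|)).

(* Vacuous, as intended, when there is no change-point. *)
Definition change_class n (r : nat) (zeta : R) :
    set ('I_n -> cumulativeBounded (0 : R) (1 : R)) :=
  [set eta | let tau := change_points eta in
    let tau_ := nth 0%N (extended n tau) in
    forall k, (1 <= k <= size tau)%N ->
      (r <= spacing n tau k)%N /\
      zeta <= supnorm (cdf_at eta (tau_ k) \- cdf_at eta (tau_ k.-1))].

Record estimator n m := Estimator {
  estimate :> n.-tuple (m.-tuple (measurableTypeR R)) -> seq nat ;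
  estimate_increasing : forall y, sorted ltn (estimate y) ;
  (* measurability for the discrete sigma-algebra on the countable [seq nat] *)
  estimate_measurable : forall B : set (seq nat), measurable (estimate @^-1` B) }.

End model.

(* Main.v *)
Require Import Defs.
From HB Require Import structures.
From mathcomp Require Import all_boot all_order all_algebra.
From mathcomp Require Import all_classical all_reals all_analysis.
From mathcomp Require Import ring lra zify.

(** The proof is a two-hypotheses testing argument in the manner of Le Cam and
    Ingster.  All observations are taken in {0, 1}.  Under the null hypothesis
    every F_t is the fair Bernoulli distribution, so that K = 0.  Cut the times
    into consecutive blocks of length r; the j-th alternative changes the success
    probability to 1/2 + zeta on the j-th block only, so that K <> 0.  Moving the
    success probability by zeta moves the distribution function by zeta, hence
    the alternatives that leave at least r times after their block all lie in
    the class ([change_class_block]); there are N = n %/ r - 1 of them.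

    An estimator with K-hat <> 0 errs under the null, and one with K-hat = 0 errs
    under every alternative.  It is thus enough that no test separates the null
    from the uniform mixture of the alternatives with total error below 1/2,
    which holds as soon as the chi-square divergence of the mixture from the
    null is at most 1 ([exists_error_ge_quarter]).  The chi-square integral
    factorises over times and replicates ([sample_pmf_affinity]): the likelihood
    ratios of two distinct blocks are uncorrelated, and a single one has second
    moment (1 + 4 zeta^2)^(m r) <= exp (4 m r zeta^2).  The divergence is
    therefore at most (exp (4 m r zeta^2) - 1) / N.  With c = 1/8 the
    exponential is at most sqrt (n / r), which is at most N + 1 because
    n / r >= 4 ([second_moment_le]).

    Every sequence used has a law carried by finitely many points, so the whole
    argument takes place on finite sums of products of Bernoulli weights, which
    bound the probabilities from below ([sample_law_ge]). *)

Set Implicit Arguments.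
Unset Strict Implicit.
Unset Printing Implicit Defensive.
Import Order.TTheory GRing.Theory Num.Theory.
Import numFieldNormedType.Exports.

Local Open Scope classical_set_scope.
Local Open Scope ring_scope.

(** * Testing a point against a finite mixture *)

(** Le Cam's two-point method against the uniform mixture [M] of the [p j].  The
    second-moment hypothesis makes the chi-square divergence of [M] from [q] at
    most 1, so that their total variation distance is at most 1/2 by
    Cauchy-Schwarz; the two errors of the test [A] then sum to at least 1/2.
    The average over [j] being at least 1/4 forces some [j] to be. *)
Lemma exists_error_ge_quarter (R : realFieldType) (Omega J : finType)
    (q : Omega -> R) (p : J -> Omega -> R) (A : pred Omega) :
  (0 < #|J|)%N -> (forall w, 0 < q w) -> \sum_w q w = 1 ->
  (forall j, \sum_w p j w = 1) ->
  (forall j k, \sum_w p j w * p k w / q w <=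
     if j == k then #|J|.+1%:R else 1) ->
  1 / 4 <= \sum_(w | A w) q w \/ exists j, 1 / 4 <= \sum_(w | ~~ A w) p j w.
Proof.
move=> J0 q0 q1 p1 pp.
pose N : R := #|J|%:R.
have N0 : 0 < N by rewrite ltr0n.
pose M w := N^-1 * \sum_j p j w.
have M1 : \sum_w M w = 1.
  rewrite -mulr_sumr exchange_big/= (eq_bigr (fun=> 1)) => [|j _]; last exact: p1.
  by rewrite sumr_const mulVf ?gt_eqF.
have M2 : \sum_w M w ^+ 2 / q w <= 2.
  have -> : \sum_w M w ^+ 2 / q w =
      N^-1 ^+ 2 * \sum_j \sum_k \sum_w p j w * p k w / q w.
    under [in RHS]eq_bigr do rewrite exchange_big/=.
    rewrite exchange_big/= mulr_sumr; apply: eq_bigr => w _.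
    rewrite exprMn -mulrA; congr (_ * _).
    rewrite expr2 mulr_suml mulr_suml; apply: eq_bigr => j _.
    by rewrite mulr_sumr mulr_suml.
  have le2 : \sum_j \sum_k \sum_w p j w * p k w / q w <= 2 * N ^+ 2.
    rewrite (_ : 2 * N ^+ 2 = \sum_(j : J) (2 * N)); last first.
      by rewrite sumr_const -[RHS]mulr_natr -/N expr2 mulrA.
    apply: ler_sum => j _.
    apply: (le_trans (ler_sum _ (fun k _ => pp j k))).
    rewrite (eq_bigr (fun k => 1 + if k == j then N else 0)) => [|k _].
      by rewrite big_split/= sumr_const -big_mkcond big_pred1_eq -/N mulr_natl mulr2n.
    by rewrite eq_sym; case: eqP => _; rewrite ?addr0// -natr1 addrC.
  rewrite exprVn mulrC ler_pdivrMr ?exprn_gt0//.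
have ME w : M w = N^-1 * \sum_j p j w by [].
clearbody M.
(* The Cauchy-Schwarz step is done pointwise: (q - M) 1_(~A) is at most
   (q - M) / 2 + ((q - M)^2 / q + q) / 4, the difference being a square over 4 q
   both on A and off A.  The sum of the bound is at most 0 + (1 + 1) / 4. *)
have tot : 1 / 2 <= \sum_(w | A w) q w + \sum_(w | ~~ A w) M w.
  have : \sum_w (2^-1 * (q w - M w) + 4^-1 * (M w ^+ 2 / q w - 2 * M w + q w + q w))
     <= 1 / 2.
    rewrite big_split/= -!mulr_sumr !big_split/= !sumrN -mulr_sumr q1 M1; lra.
  rewrite (bigID A)/=.
  have -> : \sum_(w | A w) q w = 1 - \sum_(w | ~~ A w) q w.
    by apply/eqP; rewrite eq_sym subr_eq -q1 (bigID A)/=.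
  have [a0 b0] : 0 <= \sum_(w | A w)
       (2^-1 * (q w - M w) + 4^-1 * (M w ^+ 2 / q w - 2 * M w + q w + q w)) /\
     \sum_(w | ~~ A w) (q w - M w) <= \sum_(w | ~~ A w)
       (2^-1 * (q w - M w) + 4^-1 * (M w ^+ 2 / q w - 2 * M w + q w + q w)).
    split; [apply: sumr_ge0|apply: ler_sum] => w _; have qw := q0 w.
    - have -> : 2^-1 * (q w - M w) + 4^-1 * (M w ^+ 2 / q w - 2 * M w + q w + q w)
         = (2 * q w - M w) ^+ 2 / (4 * q w) by field; rewrite gt_eqF.
      by rewrite divr_ge0 ?sqr_ge0// mulr_ge0// ltW.
    - rewrite -subr_ge0.
      have -> : 2^-1 * (q w - M w) + 4^-1 * (M w ^+ 2 / q w - 2 * M w + q w + q w)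
         - (q w - M w) = M w ^+ 2 / (4 * q w) by field; rewrite gt_eqF.
      by rewrite divr_ge0 ?sqr_ge0// mulr_ge0// ltW.
  by move: b0; rewrite big_split/= sumrN; lra.
have [qA|qA] := leP (1 / 4) (\sum_(w | A w) q w); [by left|right].
apply/existsP; apply: contraPT tot => /existsPn lt4; apply/negP; rewrite -ltNge.
suff : \sum_(w | ~~ A w) M w <= 1 / 4 by lra.
under eq_bigr do rewrite ME.
rewrite -mulr_sumr exchange_big/= mulrC ler_pdivrMr//.
rewrite (_ : _ * N = \sum_(j : J) (1 / 4)); last by rewrite sumr_const mulr_natr.
by apply: ler_sum => j _; rewrite ltW// ltNge.
Qed.

(** * Second moments of Bernoulli likelihood ratios *)

Lemma sum_ffun_prod_div (R : fieldType) (I S : finType) (P Q q : I -> S -> R) :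
  \sum_(w : {ffun I -> S}) (\prod_i P i (w i)) * (\prod_i Q i (w i)) / (\prod_i q i (w i))
  = \prod_i \sum_s P i s * Q i s / q i s.
Proof.
rewrite bigA_distr_bigA/=; apply: eq_bigr => w _.
by rewrite prodf_div big_split.
Qed.

Section bernoulli_samples.
Context (R : realType).

Definition sample_pmf n m (p : 'I_n -> R) (w : {ffun 'I_n -> {ffun 'I_m -> bool}}) : R :=
  \prod_t \prod_i bernoulli_pmf (p t) (w t i).

Lemma sum_sample_pmf n m (p : 'I_n -> R) : \sum_w sample_pmf (m := m) p w = 1.
Proof.
rewrite -(bigA_distr_bigA (fun t (s : {ffun 'I_m -> bool}) =>
  \prod_i bernoulli_pmf (p t) (s i))) big1// => t _.
rewrite -(bigA_distr_bigA (fun=> bernoulli_pmf (p t))) big1// => i _.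
by rewrite big_bool /= subrKC.
Qed.

(** The cross second moment of two likelihood ratios with respect to fair coins:
    by independence it is a product, and a single coin contributes
    2 (a b + (1 - a) (1 - b)) = 1 + 4 (a - 1/2) (b - 1/2). *)
Lemma sample_pmf_affinity n m (p p' : 'I_n -> R) :
  \sum_w sample_pmf (m := m) p w * sample_pmf p' w / sample_pmf (fun=> 1 / 2) w =
  \prod_t (1 + 4 * (p t - 1 / 2) * (p' t - 1 / 2)) ^+ m.
Proof.
pose pmf (a : R) (s : {ffun 'I_m -> bool}) := \prod_i bernoulli_pmf a (s i).
rewrite (sum_ffun_prod_div (fun t => pmf (p t)) (fun t => pmf (p' t)) (fun=> pmf (1 / 2))).
apply: eq_bigr => t _.
rewrite (sum_ffun_prod_div (fun=> bernoulli_pmf (p t)) (fun=> bernoulli_pmf (p' t))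
  (fun=> bernoulli_pmf (1 / 2))).
rewrite prodr_const card_ord; congr (_ ^+ _).
by rewrite big_bool/=; field.
Qed.

End bernoulli_samples.

Lemma card_block n r j : (0 < r)%N -> (#|[pred t : 'I_n | t %/ r == j]%N| <= r)%N.
Proof.
move=> r0; rewrite -[leqRHS]card_ord.
rewrite -(card_in_imset (f := fun t : 'I_n => Ordinal (ltn_pmod t r0))).
  exact: max_card.
move=> s t; rewrite !inE => /eqP sj /eqP tj /(congr1 val)/= st.
by apply: val_inj; rewrite /= (divn_eq s r) (divn_eq t r) sj tj st.
Qed.

Section bump.
Context (R : realType).

Definition bump_param n r (zeta : R) (j : nat) (t : 'I_n) : R :=
  if (t %/ r == j)%N then 1 / 2 + zeta else 1 / 2.

(** Disjoint bumps are uncorrelated under the null, since at every time one of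
    the two parameters is 1/2; only the diagonal terms carry information. *)
Lemma bump_affinity n m r zeta j k : (0 < r)%N ->
  \sum_w sample_pmf (n := n) (m := m) (bump_param r zeta j) w *
         sample_pmf (bump_param r zeta k) w / sample_pmf (fun=> 1 / 2) w <=
  if j == k then (1 + 4 * zeta ^+ 2) ^+ (m * r) else 1.
Proof.
move=> r0; rewrite sample_pmf_affinity.
have z0 : 0 <= 4 * zeta ^+ 2 by rewrite mulr_ge0// sqr_ge0.
rewrite (eq_bigr (fun t : 'I_n => if (t %/ r == j)%N && (j == k)
    then (1 + 4 * zeta ^+ 2) ^+ m else 1)); last first.
  move=> t _; rewrite /bump_param.
  have [->|tj] := eqVneq (t %/ r)%N j.
    have [_|_] := eqVneq j k.
      by rewrite [1 / 2 + _]addrC addrK expr2 mulrA.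
    by rewrite subrr mulr0 addr0 expr1n.
  by rewrite /= subrr mulr0 mul0r addr0 expr1n.
have [jk|jk] := eqVneq j k; last by rewrite big1// => t _; rewrite andbF.
under eq_bigr do rewrite andbT.
rewrite -big_mkcond prodr_const -exprM.
by rewrite ler_weXn2l ?lerDl// leq_mul2l card_block ?orbT.
Qed.

End bump.

(** * Bernoulli distribution functions *)

Section bernoulli_cdf.
Context (R : realType).

Definition bernoulli_point (b : bool) : measurableTypeR R := b%:R.

Lemma measurable_bernoulli_point : measurable_fun [set: bool] bernoulli_point.
Proof. by []. Qed.

HB.instance Definition _ :=
  @isMeasurableFun.Build _ _ _ _ bernoulli_point measurable_bernoulli_point.

Definition bernoulli_law (p : R) : probability (measurableTypeR R) R :=
  distribution (bernoulli_prob p : probability bool R) bernoulli_point.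

Definition bernoulli_cdf (p : R) (x : R) : R := fine (bernoulli_law p `]-oo, x]%classic).

(* The identity, seen as a random variable under [bernoulli_law p], turns
   [bernoulli_cdf] into the distribution function of a random variable. *)
Let idTR : measurableTypeR R -> R := idfun.
#[local] HB.instance Definition _ :=
  @isMeasurableFun.Build _ _ _ _ idTR (@measurable_id _ _ setT).

Lemma bernoulli_cdf_nd p : nondecreasing (bernoulli_cdf p).
Proof.
move=> x y xy; rewrite fine_le ?fin_num_measure//.
exact: (cdf_nondecreasing (idTR : {RV bernoulli_law p >-> R})).
Qed.

Lemma bernoulli_cdf_rc p : right_continuous (bernoulli_cdf p).
Proof.
move=> a; apply: fine_cvg.
rewrite fineK ?fin_num_measure//.
exact: (@cdf_right_continuous _ _ _ _ (idTR : {RV bernoulli_law p >-> R}) a).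
Qed.

HB.instance Definition _ p := isCumulative.Build R _ R (bernoulli_cdf p)
  (@bernoulli_cdf_nd p) (@bernoulli_cdf_rc p).

Lemma bernoulli_cdf_Ny0 p : bernoulli_cdf p @ -oo --> (0:R).
Proof. exact/fine_cvg/(cvg_cdfNy0 (idTR : {RV bernoulli_law p >-> R})). Qed.

Lemma bernoulli_cdf_y1 p : bernoulli_cdf p @ +oo --> (1:R).
Proof. exact/fine_cvg/(cvg_cdfy1 (idTR : {RV bernoulli_law p >-> R})). Qed.

HB.instance Definition _ p := isCumulativeBounded.Build R 0 1 (bernoulli_cdf p)
  (@bernoulli_cdf_Ny0 p) (@bernoulli_cdf_y1 p).

Lemma ls_bernoulli_cdf p (A : set R) : measurable A ->
  lebesgue_stieltjes_measure (bernoulli_cdf p) A = bernoulli_law p A.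
Proof. exact: lebesgue_stieltjes_cdf_id. Qed.

Lemma bernoulli_law_set1 p b : 0 <= p <= 1 ->
  bernoulli_law p [set bernoulli_point b] = (bernoulli_pmf p b)%:E.
Proof.
move=> p01; rewrite /bernoulli_law /= /distribution /pushforward.
rewrite (_ : _ @^-1` _ = [set b]); last first.
  by apply/seteqP; split=> -[] /=; case: b => //= /eqP;
    rewrite /bernoulli_point ?oner_eq0// eq_sym oner_eq0.
rewrite bernoulli_probE// !diracE; case: b => /=.
  by rewrite mem_set// memNset//= mule1 mule0 adde0.
by rewrite memNset//= mem_set// mule1 mule0 add0e.
Qed.

Lemma bernoulli_cdf0 p : 0 <= p <= 1 -> bernoulli_cdf p 0 = 1 - p.
Proof.
move=> p01; rewrite /bernoulli_cdf -[RHS]/(fine (bernoulli_pmf p false)%:E).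
rewrite -bernoulli_law_set1// /bernoulli_law /= /distribution /pushforward.
congr (fine (bernoulli_prob _ _)); apply/seteqP; split=> -[] //=;
  by rewrite ?in_itv/= /bernoulli_point ?ler10// => /eqP; rewrite oner_eq0.
Qed.

(** Evaluating at 0 already gives the bound; the supremum is finite because both
    functions take values in [0, 1]. *)
Lemma supnorm_bernoulli_cdf p q : 0 <= p <= 1 -> 0 <= q <= 1 ->
  `|p - q| <= supnorm (bernoulli_cdf p \- bernoulli_cdf q).
Proof.
move=> p01 q01; apply: ub_le_sup; last first.
  by exists 0 => //=; rewrite !bernoulli_cdf0// distrC; congr (`|_|); ring.
exists 1 => _ [z _ <-] /=.
have cdf01 a : 0 <= bernoulli_cdf a z <= 1.
  rewrite fine_ge0//= -lee_fin fineK ?fin_num_measure//.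
  exact: probability_le1.
have := cdf01 p; have := cdf01 q; rewrite ler_norml; lra.
Qed.

End bernoulli_cdf.

(** * Laws on tuples evaluated at points *)

Section finite_support.
Context d (T : measurableType d) (R : realType).

Lemma measure_ge_sum_points (mu : {measure set T -> \bar R}) (S : finType)
    (pt : S -> T) (P : pred S) (A : set T) :
  injective pt -> (forall s, measurable [set pt s]) -> measurable A ->
  (forall s, P s -> A (pt s)) ->
  (\sum_(s | P s) mu [set pt s] <= mu A)%E.
Proof.
move=> pt_inj mpt mA PA; have fP : finite_set [set` P] by exact: finite_finset.
rewrite (bigfs _ (index_enum_uniq S)) => [|s _]; last by rewrite mem_index_enum.
rewrite -measure_fin_bigcup//; last first.
  by move=> i j _ _ [x [/= -> /pt_inj]].
apply: le_measure; rewrite ?inE//; first exact: fin_bigcup_measurable.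
by move=> _ [s /= Ps ->]; exact: PA.
Qed.

Lemma product_law_set1 n (P : 'I_n -> probability T R) (x : n.-tuple T) :
  (forall i, measurable [set tnth x i]) ->
  product_law P [set x] = (\prod_i P i [set tnth x i])%E.
Proof.
move=> mx; rewrite -(product_law_box P (A := fun i => [set tnth x i]))//.
congr (product_law P _).
apply/seteqP; split=> y /=; first by move=> ->.
by move=> yx; apply: eq_from_tnth.
Qed.

Lemma measurable_tuple_set1 n (x : n.-tuple T) :
  (forall i, measurable [set tnth x i]) -> measurable [set x].
Proof.
move=> mx; rewrite (_ : [set x] = [set y | forall i, [set tnth x i] (tnth y i)]).
  apply: (@measurable_box _ _ n (fun i => [set tnth x i])).
  exact: mx.
apply/seteqP; split=> y /=; first by move=> ->.
by move=> yx; apply: eq_from_tnth.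
Qed.

End finite_support.

(** * Lower bounds for the law of Bernoulli samples *)

Section sample_points.
Context (R : realType).

Definition sample_point n m (w : {ffun 'I_n -> {ffun 'I_m -> bool}}) :
    n.-tuple (m.-tuple (measurableTypeR R)) :=
  [tuple [tuple @bernoulli_point R (w t i) | i < m] | t < n].

Lemma sample_point_inj n m : injective (@sample_point n m).
Proof.
move=> w w' ww'; apply/ffunP => t; apply/ffunP => i.
have := congr1 (fun x => tnth (tnth x t) i) ww'; rewrite !tnth_mktuple /bernoulli_point.
by case: (w t i); case: (w' t i) => // /eqP; rewrite ?oner_eq0// eq_sym oner_eq0.
Qed.

(** Each sample point is an atom whose mass is its Bernoulli weight, by
    independence; the atoms lying in [A] are disjoint. *)
Lemma sample_law_ge n m (p : 'I_n -> R) (P : pred {ffun 'I_n -> {ffun 'I_m -> bool}})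
    (A : set (n.-tuple (m.-tuple (measurableTypeR R)))) :
  (forall t, 0 <= p t <= 1) -> measurable A ->
  (forall w, P w -> A (sample_point w)) ->
  ((\sum_(w | P w) sample_pmf p w)%:E <=
    sample_law m (fun t => bernoulli_cdf (p t)) A)%E.
Proof.
move=> p01 mA PA.
have m1 w t i : measurable [set tnth (tnth (@sample_point n m w) t) i].
  exact: measurable_set1.
have m2 w t : measurable [set tnth (@sample_point n m w) t].
  by apply: measurable_tuple_set1 => i; exact: m1.
have m3 w : measurable [set @sample_point n m w].
  by apply: measurable_tuple_set1 => t; exact: m2.
apply: le_trans (measure_ge_sum_points _ (@sample_point_inj n m) m3 mA PA).
rewrite -sumEFin; apply: lee_sum => w _; rewrite le_eqVlt; apply/predU1P; left.
apply: esym; apply: etrans (product_law_set1 _ (m2 w)) _.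
rewrite -prodEFin; apply: eq_bigr => t _.
apply: etrans (product_law_set1 _ (m1 w t)) _.
rewrite -prodEFin; apply: eq_bigr => i _.
by rewrite /= !tnth_mktuple -bernoulli_law_set1//; exact: ls_bernoulli_cdf.
Qed.

End sample_points.

(** * Sequences that change on one block *)

Section block_sequences.
Context (R : realType).
Local Notation cdf01 := (cumulativeBounded (0 : R) (1 : R)).

Definition block_cdfs n r j (G H : cdf01) (t : 'I_n) : cdf01 :=
  if (t %/ r == j)%N then H else G.

Lemma change_points_const n (G : cdf01) : (0 < n)%N ->
  change_points (fun _ : 'I_n => G) = [::].
Proof.
move=> n0; rewrite change_pointsE//; apply/eqP; rewrite -[_ == _]negbK -has_filter.
apply/hasPn => t; rewrite mem_iota add2n prednK// ltnS => /andP[t1 tn].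
apply/asboolP; apply; rewrite /cdf_at.
have lt1 : (t.-1 < n)%N by case: t t1 tn.
have lt2 : (t.-1.-1 < n)%N by apply: leq_ltn_trans lt1; exact: leq_pred.
by rewrite !insubT.
Qed.

(* With (j + 2) r <= n, at least r times remain after block j, so that the
   end of the block is a change-point at distance at least r from n + 1. *)
Section block.
Context (n r j : nat) (G H : cdf01).
Context (r0 : (0 < r)%N) (jn : (j.+2 * r <= n)%N) (GH : (G : R -> R) <> H).
Let eta := @block_cdfs n r j G H.

Let n0 : (0 < n)%N.
Proof. by apply: leq_trans jn; rewrite muln_gt0. Qed.

Lemma cdf_at_block t : (1 <= t <= n)%N ->
  cdf_at eta t = if (t.-1 %/ r == j)%N then H else G :> (R -> R).
Proof.
case: t => // t /= tn; rewrite /cdf_at /= insubT /= /eta /block_cdfs.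
by case: ifP.
Qed.

Let icp : is_change_points eta (change_points eta).
Proof. by apply/(is_change_pointsE _ _ n0); exact: change_pointsE. Qed.

(** The quotient by [r] only jumps at multiples of [r], and exceeds [j] from
    [j.+1 * r] on; the predecessors come from numbering times from 1. *)
Lemma mem_change_points_block t : t \in change_points eta ->
  [/\ (2 <= t <= n)%N, (r %| t.-1)%N & (t.-1 <= j.+1 * r)%N].
Proof.
rewrite change_pointsE// mem_filter mem_iota add2n prednK// ltnS.
case: t => [|[|t]]; rewrite ?andbF//= => /andP[/asboolP tP tn].
move: tP; rewrite !cdf_at_block//; last by rewrite /= ltnW.
rewrite /= => tP; split=> //.
  apply/negPn/negP => rt; apply: tP.
  by rewrite divnS// (negbTE rt) add0n.
rewrite leqNgt; apply/negP => tj; apply: tP.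
have jt : (j < t %/ r)%N by rewrite leq_divRL.
have jt1 : (j < t.+1 %/ r)%N by apply: leq_trans jt _; rewrite leq_div2r.
by rewrite !gtn_eqF.
Qed.

Lemma change_points_block_neq0 : (size (change_points eta) != 0)%N.
Proof.
apply/eqP => /size0nil cp0; have := icp; rewrite cp0 => -[_ cst _].
have jr : (j.+1 * r < n)%N.
  by apply: leq_trans jn; rewrite ltn_mul2r r0 /=.
have jr' : (j * r < n)%N.
  by apply: leq_ltn_trans jr; rewrite leq_mul2r leqnSn orbT.
have /= := cst 0%N (j * r).+1 (j.+1 * r).+1 erefl; rewrite !ltnS => /(_ jr' jr).
rewrite !cdf_at_block//= !mulnK// eqxx gtn_eqF// => HG.
exact: GH.
Qed.

(** The numbers 1 = tau_0 < ... < tau_K are congruent to 1 modulo r, so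
    consecutive ones are at least r apart; the gap up to n + 1 is where the times
    left after block j are used.  Consecutive segments carry distinct functions
    among G and H, hence one of the two assumed gaps in sup norm. *)
Lemma change_class_block zeta : zeta <= supnorm (G \- H) -> zeta <= supnorm (H \- G) ->
  change_class r zeta eta.
Proof.
move=> zGH zHG tau tau_ k /andP[k1 ks].
have [s_ext cst jump] := icp.
have tauP i : (1 <= i <= size tau)%N -> tau_ i \in tau.
  by move=> iP; apply/(mem_extended n); exists i.
have extP i : (i <= size tau)%N -> [/\ (1 <= tau_ i <= n)%N, (r %| (tau_ i).-1)%N &
    ((tau_ i).-1 <= j.+1 * r)%N].
  case: i => [|i] ilt; first by rewrite /tau_ /= n0 dvdn0.
  have [/andP[i2 in1] ri ji] := mem_change_points_block (tauP i.+1 ilt).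
  by rewrite (ltnW i2).
have gap i : (i < size tau)%N -> (r <= tau_ i.+1 - tau_ i)%N.
  move=> ilt; have [/andP[a1 _] ra _] := extP i (ltnW ilt).
  have [/andP[b1 _] rb _] := extP i.+1 ilt.
  have ab : (tau_ i < tau_ i.+1)%N by exact: nth_extended_lt (leqW ilt) (ltnSn i).
  rewrite -(prednK a1) -(prednK b1) subSS; apply: dvdn_leq; last exact: dvdn_sub.
  by rewrite subn_gt0 -ltnS !prednK.
split.
  have gapk : (r <= tau_ k - tau_ k.-1)%N.
    by have := gap k.-1; rewrite prednK//; apply.
  change (r <= minn (tau_ k.+1 - tau_ k) (tau_ k - tau_ k.-1))%N.
  rewrite leq_min gapk andbT.
  move: ks; rewrite leq_eqVlt => /orP[/eqP kE|/gap//].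
  have [/andP[t1 tn] _ tj] := extP k (eq_leq kE).
  have -> : tau_ k.+1 = n.+1 by rewrite /tau_ kE nth_extended_last.
  rewrite -(prednK t1) subSS leq_subRL; last by apply: leq_trans tn; exact: leq_pred.
  apply: leq_trans jn; rewrite [leqRHS]mulSn addnC leq_add2l//.
have k1s : (k.-1 <= size tau)%N by apply: leq_trans ks; exact: leq_pred.
have [t1n _ _] := extP k ks.
have [s1n _ _] := extP k.-1 k1s.
have lt : (tau_ k.-1 < tau_ k)%N by apply: nth_extended_lt; rewrite ?leqW ?prednK.
have neq : cdf_at eta (tau_ k) <> cdf_at eta (tau_ k.-1).
  rewrite (cst k.-1 (tau_ k.-1) (tau_ k).-1 k1s); first by apply: jump; rewrite k1.
    by rewrite leqnn prednK.
  by case/andP: t1n => t1 _; rewrite prednK// -ltnS !prednK// lt leqnn.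
move: neq; rewrite -/tau_ !cdf_at_block//.
by case: ifP => _; case: ifP.
Qed.

End block.

End block_sequences.

(** * The signal-to-noise condition *)

(** With y = exp (4 m r zeta^2), the choice of the constant 1/8 means
    y^2 <= n / r < N + 1 where N is the integer part of n / r; as N >= 4, y > N
    would give y^2 > N^2 > N + 1.  The alternatives number N - 1, so the bound N
    is exactly what a chi-square divergence of 1 allows. *)
Lemma second_moment_le (R : realType) n m r (zeta : R) :
  (0 < r)%N -> (4 * r <= n)%N -> (0 < m)%N ->
  r%:R * zeta ^+ 2 <= 1 / 8 * (ln (n%:R / r%:R) / m%:R) ->
  (1 + 4 * zeta ^+ 2) ^+ (m * r) <= (n %/ r)%:R :> R.
Proof.
move=> r0 rn m0 small.
have n0 : (0 < n)%N by apply: leq_trans rn; rewrite muln_gt0.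
have [r0' m0' n0'] : [/\ 0 < r%:R :> R, 0 < m%:R :> R & 0 < n%:R :> R] by rewrite !ltr0n.
have z0 : 0 <= zeta ^+ 2 by rewrite sqr_ge0.
set N := (n %/ r)%N; have N4 : (4 <= N)%N by rewrite leq_divRL.
pose y := expR (4 * zeta ^+ 2 * (m * r)%:R).
have le_y : (1 + 4 * zeta ^+ 2) ^+ (m * r) <= y.
  rewrite /y expRM_natr; apply: lerXn2r; rewrite ?nnegrE ?expR_ge0 ?expR_ge1Dx//.
  by rewrite addr_ge0// mulr_ge0.
have y2 : y ^+ 2 < N.+1%:R.
  rewrite /y -expRM_natr; apply: (@le_lt_trans _ _ (n%:R / r%:R)).
    rewrite -[leRHS]lnK ?posrE ?divr_gt0// ler_expR.
    have : m%:R * (r%:R * zeta ^+ 2) <= 1 / 8 * ln (n%:R / r%:R).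
      rewrite mulrC -ler_pdivlMr// -[leRHS]mulrA; exact: small.
    rewrite natrM; nra.
  by rewrite ltr_pdivrMr// -natrM ltr_nat ltn_ceil.
apply: le_trans le_y _; rewrite leNgt; apply/negP => Ny.
have N4' : 4 <= N%:R :> R by rewrite ler_nat.
rewrite -natr1 in y2; nra.
Qed.

(** * The lower bound *)

Theorem proposition8 (R : realType) :
  exists c : R, 0 < c /\
  forall (n m r : nat) (zeta : R),
    (2 <= n)%N -> (1 <= m)%N ->
    (1 <= r)%N -> r%:R <= n%:R / 4 :> R ->
    0 < zeta -> zeta < 1 / 4 ->
    r%:R * zeta ^+ 2 <= c * (ln (n%:R / r%:R) / m%:R) ->
    ((1 / 4)%:E <=
     ereal_inf [set ereal_sup
         [set sample_law m eta
                [set y | size (tauhat y) <> size (change_points eta)]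
         | eta in @change_class R n r zeta]
       | tauhat in [set: estimator R n m]])%E.
Proof.
exists (1 / 8); split=> [|n m r zeta n2 m1 r1 rn4 z0 z4 small]; first by lra.
have rn : (4 * r <= n)%N by rewrite -(ler_nat R) natrM; lra.
have N4 : (4 <= n %/ r)%N by rewrite leq_divRL.
set N := (n %/ r)%N in N4.
have n0 : (0 < n)%N by exact: ltnW.
pose G : cumulativeBounded (0 : R) (1 : R) := bernoulli_cdf (1 / 2).
pose H : cumulativeBounded (0 : R) (1 : R) := bernoulli_cdf (1 / 2 + zeta).
have h01 : 0 <= (1 / 2 : R) <= 1 by lra.
have hz01 : 0 <= 1 / 2 + zeta <= 1 by lra.
have bp01 (j : 'I_N.-1) (t : 'I_n) : 0 <= bump_param r zeta j t <= 1.
  by rewrite /bump_param; case: ifP.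
have GH : (G : R -> R) <> H.
  move=> /(congr1 (fun f => f 0)); rewrite /G /H /= !bernoulli_cdf0//; lra.
have zGH : zeta <= supnorm (G \- H).
  apply: le_trans (supnorm_bernoulli_cdf h01 hz01).
  by rewrite opprD addNKr normrN ger0_norm// ltW.
have zHG : zeta <= supnorm (H \- G).
  apply: le_trans (supnorm_bernoulli_cdf hz01 h01).
  by rewrite addrAC subrr add0r ger0_norm// ltW.
have mErr (tauhat : estimator R n m) k : measurable [set y | size (tauhat y) <> k].
  exact: (estimate_measurable tauhat [set s | size s <> k]).
apply: le_ereal_inf_tmp => _ [tauhat _ <-].
pose A (w : {ffun 'I_n -> {ffun 'I_m -> bool}}) :=
  size (tauhat (sample_point R w)) != 0%N.
(* The estimator is used as a test: A collects the samples for which it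
   reports at least one change. *)
have [|||||qA|[j pA]] := @exists_error_ge_quarter R _ 'I_N.-1
  (sample_pmf (fun=> 1 / 2)) (fun j : 'I_N.-1 => sample_pmf (bump_param r zeta j)) A.
- by rewrite card_ord -subn1 subn_gt0 (leq_trans _ N4).
- move=> w; apply: prodr_gt0 => t _; apply: prodr_gt0 => i _.
  by rewrite /bernoulli_pmf; case: ifP => _; lra.
- exact: sum_sample_pmf.
- by move=> j; exact: sum_sample_pmf.
- move=> j k; apply: le_trans (bump_affinity n m zeta j k r1) _.
  rewrite (inj_eq val_inj); case: eqP => // _; rewrite card_ord prednK.
    exact: second_moment_le.
  exact: leq_trans N4.
- have qE : ((\sum_(w | A w) sample_pmf (fun=> 1 / 2) w)%:E <= sample_law m (fun=> G)
      [set y | size (tauhat y) <> size (change_points (fun _ : 'I_n => G))])%E.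
    rewrite change_points_const//.
    by apply: (sample_law_ge (p := fun=> 1 / 2)) => // w /eqP.
  apply: (@le_trans _ _ _ _ _ _ (ereal_sup_ubound _)); last first.
    exists (fun=> G) => //.
    rewrite /change_class /= change_points_const//= => k; lia.
  by apply: le_trans qE; rewrite lee_fin.
have jn : (j.+2 * r <= n)%N.
  rewrite -leq_divRL//; have := ltn_ord j; rewrite -/N; lia.
have etaE : (fun t : 'I_n => bernoulli_cdf (bump_param r zeta j t)
    : cumulativeBounded (0 : R) (1 : R)) = block_cdfs r j G H.
  by apply/funext => t; rewrite /bump_param /block_cdfs; case: ifP.
have pE : ((\sum_(w | ~~ A w) sample_pmf (bump_param r zeta j) w)%:E <=
    sample_law m (block_cdfs r j G H)
    [set y | size (tauhat y) <> size (change_points (@block_cdfs _ n r j G H))])%E.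
  rewrite -[in X in sample_law m X]etaE; apply: sample_law_ge => // w /negPn/eqP /= ->.
  apply/eqP; rewrite eq_sym; exact: change_points_block_neq0.
apply: (@le_trans _ _ _ _ _ _ (ereal_sup_ubound _)); last first.
  by exists (block_cdfs r j G H) => //; exact: change_class_block.
by apply: le_trans pE; rewrite lee_fin.
Qed.
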